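(* Fix an integer $\ell\ge 1$ and indeterminates $Y_1,\dots,Y_\ell$. Then $$\sum_{n=0}^{\infty}\det\big(M_{n,\ell}(\mathbf{Y})\big)\frac{x^n}{n!}=\exp\!\left(Y_1x+Y_2\frac{x^2}{2}+\cdots+Y_\ell\frac{x^\ell}{\ell}\right),$$ where the determinant of the $0\times 0$ matrix $M_{0,\ell}$ is $1$.
   Context: Let $\imath=\sqrt{-1}$. For integers $n\ge 0$, $\ell\ge 1$, $M_{n,\ell}(\mathbf{Y})$ is the $n\times n$ matrix with rows and columns indexed by $1,\dots,n$ whose $(k,j)$ entry is $\imath^{\,j-k}Y_{j-k+1}$ if $0\le j-k\le \ell-1$, is $\imath\, j$ if $k=j+1$, and is $0$ otherwise. (E.g. $M_{2,\ell}=\begin{pmatrix}Y_1 & \imath Y_2\\ \imath & Y_1\end{pmatrix}$ for $\ell\ge 2$.) *)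

(* Defs.v *)
From HB Require Import structures.
From mathcomp Require Import all_boot all_order all_algebra.
From mathcomp Require Import mpoly.

Set Implicit Arguments.
Unset Strict Implicit.
Unset Printing Implicit Defensive.

Import Order.TTheory GRing.Theory Num.Theory.
Local Open Scope ring_scope.

(* A[[x]]: the series sum_n f_n x^n is its coefficient sequence n |-> f_n;
   equality of series is pointwise equality =1. *)
Definition fps (A : Type) : Type := nat -> A.

Section FormalPowerSeries.
Variables (F : fieldType) (A : comAlgType F).
Implicit Types (f g : fps A) (p : {poly A}).

Definition fps_one : fps A := fun n => (n == 0%N)%:R.

Definition fps_mul f g : fps A :=
  fun n => \sum_(i < n.+1) f i * g (n - i)%N.

Definition fps_pow f (k : nat) : fps A := iter k (fps_mul f) fps_one.

Definition fps_of_poly p : fps A := fun n => p`_n.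

Definition fps_egf (a : nat -> A) : fps A := fun n => (n`!)%:R^-1 *: a n.

(* exp f = sum_(k >= 0) f^k / k!, meaningful when f 0 = 0 (and F has
   characteristic 0). The terms with k > n do not contribute to the coefficient
   of x^n, see fps_pow_eq0. *)
Definition fps_exp f : fps A :=
  fun n => \sum_(k < n.+1) (k`!)%:R^-1 *: fps_pow f k n.

Lemma fps_pow_eq0 f k n : f 0%N = 0 -> (n < k)%N -> fps_pow f k n = 0.
Proof.
move=> f0; elim: k n => [//|k IHk] n; rewrite ltnS => le_nk.
rewrite /fps_pow iterS /fps_mul big1 // => -[i /= lt_in] _.
case: i lt_in => [|i] lt_in; first by rewrite f0 mul0r.
have lt_ik : (n - i.+1 < k)%N.
  by apply: leq_trans le_nk; rewrite ltn_subrL; case: n lt_in.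
by rewrite [X in _ * X]IHk ?mulr0.
Qed.

Lemma fps_exp_widen f n N : f 0%N = 0 -> (n <= N)%N ->
  \sum_(k < N.+1) (k`!)%:R^-1 *: fps_pow f k n = fps_exp f n.
Proof.
move=> f0 le_nN; rewrite /fps_exp.
rewrite [RHS](big_ord_widen N.+1 (fun k => (k`!)%:R^-1 *: fps_pow f k n)) //.
rewrite [RHS]big_mkcond /=; apply: eq_bigr => k _.
by case: ltnP => // lt_nk; rewrite fps_pow_eq0 ?scaler0.
Qed.

End FormalPowerSeries.

(* Indices are 0-based: the entry (k, j) here is the entry (k+1, j+1) of
   M_{n,l}(Y), and Y`_m stands for Y_{m+1}. *)
Definition Mmx (C : numClosedFieldType) (A : comAlgType C) (n l : nat)
    (Y : l.-tuple A) : 'M[A]_n :=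
  \matrix_(k < n, j < n)
    if ((k <= j) && (j - k <= l - 1))%N then 'i ^+ (j - k) *: Y`_(j - k)
    else if k == j.+1 :> nat then ('i * j.+1%:R)%:A
    else 0.

Definition indets (C : numClosedFieldType) (l : nat) : l.-tuple {mpoly C[l]} :=
  [tuple 'X_i | i < l].

(* Main.v *)
Require Import Defs.
From HB Require Import structures.
From mathcomp Require Import all_boot all_order all_algebra.
From mathcomp Require Import mpoly.

Set Implicit Arguments.
Unset Strict Implicit.
Unset Printing Implicit Defensive.

Import Order.TTheory GRing.Theory Num.Theory.
Local Open Scope ring_scope.

(** Write [y_i] for Y_{i+1}. Both sides have constant coefficient 1 and satisfy
    [(n + 1) a_(n+1) = \sum_(i <= n) y_i a_(n-i)]. For the exponential, this
    is [E' = p' E]. For the determinants, it is the expansion of an upper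
    Hessenberg determinant along its last column, in which the powers of the
    imaginary unit cancel the signs of the cofactors. *)

Lemma det_hessenberg_last_col (R : comNzRingType) (h : nat -> nat -> R)
    (v : nat -> R) (n : nat) :
  (forall i j, (j.+1 < i)%N -> h i j = 0) ->
  \det (\matrix_(i < n.+1, j < n.+1) (if j == n :> nat then v i else h i j)) =
  \sum_(k < n.+1) v k * (\prod_(k <= j < n) - h j.+1 j)
                      * \det (\matrix_(i < k, j < k) h i j).
Proof.
(* Induction through the last row, which has only two nonzero entries; the
   minor of the subdiagonal one has the same shape, one size smaller. *)
move=> h0; elim: n => [|n IHn].
  by rewrite det_mx11 mxE big_ord1 big_geq // det_mx00 !mulr1.
rewrite [RHS]big_ord_recr /= (expand_det_row _ ord_max).
rewrite [in LHS]big_ord_recr [in LHS]big_ord_recr /=.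
rewrite big1 => [|i _]; last first.
  by rewrite mxE /= ltn_eqF ?h0 ?mul0r ?ltnS ?ltn_ord // ltnW.
rewrite add0r !mxE /= eqxx (ltn_eqF (ltnSn n)) [in RHS]big_geq // mulr1.
congr (_ + _); last first.
  congr (_ * _); rewrite /cofactor addnn -signr_odd odd_double mul1r.
  congr (\det _); apply/matrixP=> i j; rewrite !mxE /= /bump.
  by rewrite ![(n < _)%N]leqNgt !ltn_ord (ltn_eqF (ltn_ord j)).
(* The cofactor sign here is $(-1)^{2n+1}$; it produces the new factor [- h n.+1 n] of the
   product. *)
rewrite /cofactor addSn addnn -signr_odd /= odd_double mulN1r.
set M := row' _ _.
(* Column [n] is deleted, so the column [v] slides into its place: keeping [v] independent of [h] is
   what lets the induction close. *)
have -> : M = \matrix_(i < n.+1, j < n.+1)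
                (if j == n :> nat then v i else h i j).
  apply/matrixP=> i j; rewrite !mxE /= /bump [(n < i)%N]leqNgt ltn_ord /=.
  have := ltn_ord j; rewrite ltnS leq_eqVlt => /predU1P[-> | lt_jn].
    by rewrite leqnn !eqxx add0n.
  by rewrite leqNgt lt_jn !add0n !ltn_eqF // ltnW.
rewrite IHn mulrN -mulNr big_distrr; apply: eq_bigr => k _ /=.
rewrite big_nat_recr /=; last by rewrite -ltnS.
by rewrite !mulrA; congr (_ * _); rewrite -mulrA mulrC.
Qed.

Section Recurrences.
Variables (C : numClosedFieldType) (A : comAlgType C).

(** The subdiagonal entries from [k] to [n - 1] multiply, with signs, to $(-\imath)^{n-k}\, n!/k!$,
    and the last column supplies $\imath^{n-k}$; since $\imath\cdot(-\imath)=1$, only the factorials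
    remain. *)
Lemma det_Mmx_rec (l : nat) (Y : l.-tuple A) (n : nat) : (1 <= l)%N ->
  \det (Mmx n.+1 Y) =
  \sum_(k < n.+1) ((n`!)%:R / (k`!)%:R : C) *: (Y`_(n - k) * \det (Mmx k Y)).
Proof.
move=> l_gt0.
(* The band condition is dropped: past index [l - 1] the default value of [nth] makes the entry 0
   anyway. *)
pose h i j : A := if (i <= j)%N then 'i ^+ (j - i) *: Y`_(j - i)
  else if i == j.+1 then ('i * j.+1%:R)%:A else 0.
have MmxE m : Mmx m Y = \matrix_(i < m, j < m) h i j.
  apply/matrixP=> i j; rewrite !mxE /h; case: leqP => //= le_ij.
  case: leqP => // lt_l; rewrite [Y`_ _]nth_default ?scaler0; last first.
    by rewrite size_tuple; case: l l_gt0 lt_l {Y h} => // l _; rewrite subn1.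
  by rewrite ltn_eqF // ltnS.
have h0 i j : (j.+1 < i)%N -> h i j = 0.
  by move=> lt_ji; rewrite /h leqNgt ltnW //= gtn_eqF.
have prod_sub k : (k <= n)%N ->
    \prod_(k <= j < n) - h j.+1 j =
    ((- 'i) ^+ (n - k) * ((n`!)%:R / (k`!)%:R))%:A.
  elim: n => [|m IHm].
    by rewrite leqn0 => /eqP->; rewrite big_geq // divff ?mulr1 ?scale1r ?oner_eq0.
  rewrite leq_eqVlt => /predU1P[-> | lt_km].
    by rewrite big_geq // subnn mul1r divff ?scale1r // pnatr_eq0 -lt0n fact_gt0.
  rewrite big_nat_recr //= IHm // /h ltnn eqxx -scaleNr -scalerAl mul1r scalerA.
  congr (_ *: _); rewrite subSn // exprS factS natrM -mulNr.
  by rewrite mulrACA [_ * - 'i]mulrC [_ * m.+1%:R]mulrC -!mulrA.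
have -> : Mmx n.+1 Y = \matrix_(i < n.+1, j < n.+1)
    (if j == n :> nat then h i n else h i j).
  by rewrite MmxE; apply/matrixP=> i j; rewrite !mxE; case: eqP => // ->.
rewrite (det_hessenberg_last_col (fun i => h i n)) //.
apply: eq_bigr => k _; have le_kn : (k <= n)%N by rewrite -ltnS.
rewrite prod_sub // -MmxE /h le_kn -scalerAr mulr1 scalerA -scalerAl.
by congr (_ *: _); rewrite mulrAC -exprMn mulNr -expr2 sqrCi opprK expr1n mul1r.
Qed.

Lemma fps_pow_of_poly (p : {poly A}) (k n : nat) :
  fps_pow (fps_of_poly p) k n = (p ^+ k)`_n.
Proof.
elim: k n => [|k IHk] n; first by rewrite expr0 coef1.
rewrite exprS coefM; apply: eq_bigr => i _; congr (_ * _); exact: IHk.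
Qed.

(** Coefficient of $x^n$ in $E' = p'E$, obtained termwise from $(p^{k+1}/(k+1)!)' = p'\,p^k/k!$. *)
Lemma fps_exp_poly_rec (p : {poly A}) (n : nat) : p`_0 = 0 ->
  fps_exp (fps_of_poly p) n.+1 *+ n.+1 =
  \sum_(i < n.+1) p^`()`_i * fps_exp (fps_of_poly p) (n - i)%N.
Proof.
move=> p0; rewrite {1}/fps_exp big_ord_recl fps_pow_of_poly coef1 scaler0 add0r.
(* All truncated exponential sums are extended to the common bound [n], so that the two summations
   can be exchanged. *)
under [RHS]eq_bigr => i _ do
  rewrite -[X in _ * X](@fps_exp_widen _ _ _ _ n) ?leq_subr // big_distrr.
rewrite exchange_big -sumrMnl; apply: eq_bigr => k _.
rewrite lift0 fps_pow_of_poly scalerMnr -coef_deriv deriv_exp coefMn /=.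
rewrite -scaler_nat scalerA factS natrM invfM mulrAC mulVf ?pnatr_eq0 // mul1r.
rewrite coefM scaler_sumr; apply: eq_bigr => i _.
by rewrite fps_pow_of_poly scalerAr.
Qed.

End Recurrences.

Theorem theorem7p1 (C : numClosedFieldType) (l : nat) (hl : (1 <= l)%N) :
  let Y : l.-tuple {mpoly C[l]} := indets C l in
  fps_egf (fun n => \det (Mmx n Y))
  =1 fps_exp (fps_of_poly (\sum_(j < l) (j.+1%:R^-1 *: Y`_j)%:P * 'X^(j.+1))).
Proof.
move=> Y; set p := \sum_(j < l) _.
have p0 : p`_0 = 0.
  by rewrite coef_sum big1 // => j _; rewrite coefCM coefXn mulr0.
(* Valid for every [i]: for [i >= l] both sides are 0, the right one by the default value of
   [nth]. *)
have p'E i : p^`()`_i = Y`_i.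
  rewrite coef_deriv coef_sum; case: (ltnP i l) => [lt_il | le_li].
    rewrite (bigD1 (Ordinal lt_il)) //= big1 => [|j ne_ji].
      rewrite coefCM coefXn eqxx mulr1 addr0 scalerMnl -mulr_natr.
      by rewrite mulVf ?pnatr_eq0 // scale1r.
    rewrite coefCM coefXn eqSS eq_sym.
    by rewrite (negPf ne_ji : (j == i :> nat) = _) mulr0.
  rewrite [RHS]nth_default ?size_tuple // big1 ?mul0rn // => j _.
  by rewrite coefCM coefXn eqSS gtn_eqF ?mulr0 // (leq_trans (ltn_ord j)).
have fact_neq0 m : (m`!)%:R != 0 :> C by rewrite pnatr_eq0 -lt0n fact_gt0.
elim/ltn_ind => -[_ | n IHn].
  by rewrite /fps_egf /fps_exp det_mx00 big_ord1 /fps_pow /fps_one.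
have n1_neq0 : n.+1%:R != 0 :> C by rewrite pnatr_eq0.
apply: (scalerI n1_neq0); rewrite [RHS]scaler_nat fps_exp_poly_rec //.
rewrite /fps_egf det_Mmx_rec // scalerA factS natrM invfM mulrA divff // mul1r.
(* The determinant recurrence is indexed by the size of the minor, the other one by the index of
   [Y]; reversing the sum matches them. *)
rewrite scaler_sumr (reindex_inj rev_ord_inj); apply: eq_bigr => i _ /=.
have le_in : (i <= n)%N by rewrite -ltnS.
rewrite subSS subKn // p'E -IHn ?ltnS ?leq_subr // scalerA mulrA mulVf //.
by rewrite mul1r /fps_egf scalerAr.
Qed.
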